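(* Let $K$ be a Henselian valued field with nontrivial valuation, and let $D$ be a tame finite-dimensional central division algebra over $K$. If $D$ is noncommutative, then the multiplicative group $D^*=D\setminus\{0\}$ contains no abelian maximal subgroup.
   Context: A valuation on a division ring $D$ is a function $v:D\to\Gamma\cup\{\infty\}$, where $\Gamma$ is a totally ordered additive abelian group and $\infty$ is larger than every element of $\Gamma$ and absorbing for addition, such that for all $x,y\in D$: $v(x)=\infty$ iff $x=0$; $v(x+y)\ge\min\{v(x),v(y)\}$; $v(xy)=v(x)+v(y)$. Its value group is $\Gamma_D=v(D^* )$. The valuation is nontrivial if it takes a nonzero value on some nonzero element. A valued field $(K,v)$ is Henselian if $v$ extends uniquely to every algebraic extension of $K$; in that case $v$ extends uniquely to a valuation on every finite-dimensional central division algebra $D$ over $K$ (i.e. $Z(D)=K$ and $[D:K]<\infty$), and $D$ is always considered with this valuation. For $\gamma\in\Gamma_D$ put $D^{\ge\gamma}=\{d\in D: v(d)\ge\gamma\}$ and $D^{>\gamma}=\{d\in D: v(d)>\gamma\}$ (both containing $0$). The associated graded ring is $\mathbf{gr}(D)=\bigoplus_{\gamma\in\Gamma_D}D^{\ge\gamma}/D^{>\gamma}$; for $a\in D^*$ write $\widetilde a=a+D^{>v(a)}$; multiplication is determined by $\widetilde a\,\widetilde b=\widetilde{ab}$. It is a graded division ring (every nonzero homogeneous element is invertible). $\mathbf{gr}(K)$ is the associated graded field of $K$ for the restricted valuation, viewed as a graded subring of $\mathbf{gr}(D)$, and $[\mathbf{gr}(D):\mathbf{gr}(K)]$ is the rank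 of $\mathbf{gr}(D)$ as a (free) graded $\mathbf{gr}(K)$-module. $D$ is called tame over the Henselian field $K$ if $[\mathbf{gr}(D):\mathbf{gr}(K)]=[D:K]$ and $Z(\mathbf{gr}(D))=\mathbf{gr}(K)$. A maximal subgroup of a group $G$ is a proper subgroup not properly contained in any proper subgroup of $G$. *)

(* Defs.v *)
From HB Require Import structures.
From mathcomp Require Import all_boot all_order all_algebra all_field.

Set Implicit Arguments.
Unset Strict Implicit.
Unset Printing Implicit Defensive.

Import Order.TTheory GRing.Theory Num.Theory.
Local Open Scope ring_scope.
Local Open Scope quotient_scope.

HB.mixin Record isOrderedGroup G of Num.POrderedZmodule G := {
  og_le_total : total (<=%R : rel G);
  og_leD_subdef : forall z x y : G, x <= y -> z + x <= z + y
}.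

#[short(type="orderedGroupType")]
HB.structure Definition OrderedGroup :=
  {G of Num.POrderedZmodule G & isOrderedGroup G}.

Section OrderedGroupTheory.
Variable G : orderedGroupType.
Implicit Types x y z : G.

Lemma og_leD2l z x y : (z + x <= z + y) = (x <= y).
Proof.
apply/idP/idP; last exact: og_leD_subdef.
by move=> /(og_leD_subdef (- z)); rewrite !addKr.
Qed.

Lemma og_leD2r z x y : (x + z <= y + z) = (x <= y).
Proof. by rewrite ![_ + z]addrC og_leD2l. Qed.

Lemma og_leNgt x y : (x <= y) = ~~ (y < x).
Proof. by rewrite comparable_leNgt // /Order.comparable og_le_total. Qed.

Lemma og_ltNge x y : (x < y) = ~~ (y <= x).
Proof. by rewrite og_leNgt negbK. Qed.

Lemma og_ltD2l z x y : (z + x < z + y) = (x < y).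
Proof. by rewrite !og_ltNge og_leD2l. Qed.

Lemma og_double_eq0 x : x + x = 0 -> x = 0.
Proof.
move=> x2; have xN : x = - x by apply/eqP; rewrite -addr_eq0 x2.
apply: le_anti; have /orP[x0|x0] := og_le_total x 0; rewrite x0 ?andbT /=.
  by have := x0; rewrite -(og_leD2l (- x)) addNr addr0 -xN.
by have := x0; rewrite -(og_leD2l (- x)) addNr addr0 -xN.
Qed.

End OrderedGroupTheory.

(** In [option G], [None] is the point at infinity. *)

Section Infinity.
Variable G : orderedGroupType.
Implicit Types a b : option G.

Definition vle a b : bool :=
  match a, b with
  | _, None => true
  | None, Some _ => false
  | Some x, Some y => x <= y
  end.

Definition vlt a b : bool := ~~ vle b a.

Definition vmin a b : option G := if vle a b then a else b.

Definition vadd a b : option G :=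
  match a, b with
  | Some x, Some y => Some (x + y)
  | _, _ => None
  end.

Lemma vle_refl a : vle a a. Proof. by case: a => /=. Qed.

Lemma vle_trans b a c : vle a b -> vle b c -> vle a c.
Proof. by case: a b c => [x|] [y|] [z|] //=; apply: le_trans. Qed.

Lemma vltW a b : vlt a b -> vle a b.
Proof. by case: a b => [x|] [y|] //=; rewrite /vlt /= -og_ltNge => /ltW. Qed.

Lemma vle_total a b : vle a b || vle b a.
Proof. by case: a b => [x|] [y|] //=; exact: og_le_total. Qed.

Lemma vle_min a b c : vle a b -> vle a c -> vle a (vmin b c).
Proof. by rewrite /vmin; case: ifP. Qed.

Lemma vlt_min a b c : vlt a b -> vlt a c -> vlt a (vmin b c).
Proof. by rewrite /vmin; case: ifP. Qed.

Lemma vlt_le_trans b a c : vlt a b -> vle b c -> vlt a c.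
Proof.
case: a b c => [x|] [y|] [z|] //=; rewrite /vlt /= -!og_ltNge.
exact: lt_le_trans.
Qed.

Lemma vleD a b c d : vle a b -> vle c d -> vle (vadd a c) (vadd b d).
Proof.
case: a b c d => [a|] [b|] [c|] [d|] //= h h'.
by apply: (@le_trans _ _ (a + d)); rewrite ?og_leD2l ?og_leD2r.
Qed.

Lemma vltDl (a c : G) (b d : option G) :
  vlt (Some a) b -> vle (Some c) d -> vlt (Some (a + c)) (vadd b d).
Proof.
case: b d => [b|] [d|] //=; rewrite /vlt /= -?og_ltNge => h h'.
apply: (@lt_le_trans _ _ (b + c)); last by rewrite og_leD2l.
by rewrite ![_ + c]addrC og_ltD2l.
Qed.

Lemma vltDr (a c : G) (b d : option G) :
  vle (Some a) b -> vlt (Some c) d -> vlt (Some (a + c)) (vadd b d).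
Proof.
move=> h h'; rewrite addrC.
have -> : vadd b d = vadd d b by case: b d {h h'} => [b|] [d|] //=; rewrite addrC.
exact: vltDl.
Qed.

End Infinity.

Arguments vle : simpl never.
Arguments vlt : simpl never.

Record valuation (G : orderedGroupType) (R : nzRingType) := Valuation {
  val_fun :> R -> option G;
  val_infP : forall x, val_fun x = None <-> x = 0;
  val_min : forall x y, vle (vmin (val_fun x) (val_fun y)) (val_fun (x + y));
  val_mul : forall x y, val_fun (x * y) = vadd (val_fun x) (val_fun y)
}.

Section ValuationTheory.
Variables (G : orderedGroupType) (R : nzRingType) (v : valuation G R).
Implicit Types x y : R.

Lemma val0 : v 0 = None. Proof. by apply/val_infP. Qed.

Lemma val1 : v 1 = Some 0.
Proof.
have := val_mul v 1 1; rewrite mulr1.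
case E: (v 1) => [g|] /=; last first.
  by move/val_infP: E => /eqP; rewrite oner_eq0.
by case=> h; congr Some; apply: (addrI g); rewrite addr0 -h.
Qed.

Lemma valN x : v (- x) = v x.
Proof.
have vN1 : v (-1) = Some 0.
  have := val_mul v (-1) (-1); rewrite mulrNN mulr1 val1.
  by case: (v (-1)) => [g|] //= [/esym/og_double_eq0->].
rewrite -mulN1r val_mul vN1.
by case: (v x) => [g|] //=; rewrite add0r.
Qed.

Lemma vle_add a x y : vle a (v x) -> vle a (v y) -> vle a (v (x + y)).
Proof. by move=> hx hy; apply: vle_trans (val_min v x y); apply: vle_min. Qed.

Lemma vlt_add a x y : vlt a (v x) -> vlt a (v y) -> vlt a (v (x + y)).
Proof.
by move=> hx hy; apply: vlt_le_trans (val_min v x y); apply: vlt_min.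
Qed.

Lemma vlt0 (g : G) : vlt (Some g) (v 0). Proof. by rewrite val0. Qed.

Lemma vle_sum (I : Type) (r : seq I) (P : pred I) (F : I -> R) (g : G) :
  (forall i, P i -> vle (Some g) (v (F i))) ->
  vle (Some g) (v (\sum_(i <- r | P i) F i)).
Proof. by move=> h; elim/big_ind: _ => //; [rewrite val0 | exact: vle_add]. Qed.

End ValuationTheory.

Definition nontrivial_valuation (G : orderedGroupType) (R : nzRingType)
    (v : valuation G R) : Prop :=
  exists2 x : R, x != 0 & v x <> Some 0.

Section Restriction.
Variables (G : orderedGroupType) (K : fieldType) (R : nzRingType).
Variables (f : {rmorphism K -> R}) (w : valuation G R).

Fact restrict_infP x : w (f x) = None <-> x = 0.
Proof.
split=> [/val_infP/eqP|->]; first by rewrite fmorph_eq0 => /eqP.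
by rewrite rmorph0 val0.
Qed.

Fact restrict_min x y :
  vle (vmin (w (f x)) (w (f y))) (w (f (x + y))).
Proof. by rewrite rmorphD val_min. Qed.

Fact restrict_mul x y : w (f (x * y)) = vadd (w (f x)) (w (f y)).
Proof. by rewrite rmorphM val_mul. Qed.

Definition restrict_valuation : valuation G K :=
  @Valuation G K (fun x => w (f x)) restrict_infP restrict_min restrict_mul.

End Restriction.

(** [w] extends [v] along [f]; the value group [G'] of the extension contains
    [G] as an ordered subgroup via [j]. *)
Definition extends_valuation (G G' : orderedGroupType) (j : G -> G')
    (K R : nzRingType) (f : K -> R) (v : valuation G K) (w : valuation G' R)
    : Prop :=
  [/\ {morph j : a b / a + b}, {mono j : a b / a <= b}
    & forall x, w (f x) = omap j (v x)].

(** Any two extensions of [v] can be compared inside a common ordered group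
    containing [G], where uniqueness is plain equality: since [L] is algebraic
    and ordered groups are torsion-free, equivalent extensions with values in
    the same ordered overgroup of [G] coincide. *)
Definition henselian (G : orderedGroupType) (K : fieldType)
    (v : valuation G K) : Prop :=
  forall (L : fieldType) (f : {rmorphism K -> L}),
    (forall x : L, algebraicOver f x) ->
    (exists (G' : orderedGroupType) (j : G -> G') (w : valuation G' L),
        extends_valuation j f v w)
    /\ (forall (G' : orderedGroupType) (j : G -> G') (w1 w2 : valuation G' L),
        extends_valuation j f v w1 -> extends_valuation j f v w2 -> w1 =1 w2).

(** An element of the direct sum of the R^{>=g} is presented as a finite formal
    sum of pairs [(g, a)] with [g <= v a]; [fcoef s g] is its component in
    degree [g].  The ring [gr v] is the quotient identifying two formal sums
    when, for all [g], their components in degree [g] agree modulo R^{>g}.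
    The degree [g] ranges over all of [G]; for [g] outside the value group
    R^{>=g} = R^{>g}, so such degrees contribute nothing. *)

Section FormalSums.
Variables (G : orderedGroupType) (R : nzRingType) (v : valuation G R).

Definition fcoef (s : seq (G * R)) (g : G) : R :=
  \sum_(p <- s | p.1 == g) p.2.

Record fsum := FSum {
  fsum_seq :> seq (G * R);
  _ : all (fun p => vle (Some p.1) (v p.2)) fsum_seq
}.

HB.instance Definition _ := [isSub for fsum_seq].
HB.instance Definition _ := [Choice of fsum by <:].

Implicit Types s t u : fsum.

Lemma fsum_le s p : p \in (s : seq _) -> vle (Some p.1) (v p.2).
Proof. by case: s => s hs /=; move/allP: hs; apply. Qed.

Fact fs0_subproof : all (fun p => vle (Some p.1) (v p.2)) [::].
Proof. by []. Qed.
Definition fs0 := FSum fs0_subproof.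

Fact fs1_subproof : all (fun p => vle (Some p.1) (v p.2)) [:: (0, 1)].
Proof. by rewrite /= val1 /vle lexx. Qed.
Definition fs1 := FSum fs1_subproof.

Fact fsD_subproof s t : all (fun p => vle (Some p.1) (v p.2)) (s ++ t).
Proof. by rewrite all_cat; apply/andP; split; apply/allP/fsum_le. Qed.
Definition fsD s t := FSum (fsD_subproof s t).

Fact fsN_subproof s :
  all (fun p => vle (Some p.1) (v p.2)) [seq (p.1, - p.2) | p <- s].
Proof. by apply/allP=> _ /mapP[p /fsum_le hp ->]; rewrite /= valN. Qed.
Definition fsN s := FSum (fsN_subproof s).

Fact fsM_subproof s t :
  all (fun p => vle (Some p.1) (v p.2))
      [seq (p.1 + q.1, p.2 * q.2) | p <- s, q <- t].
Proof.
apply/allP=> _ /allpairsP[[p q] /= [/fsum_le hp /fsum_le hq ->]] /=.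
by rewrite val_mul -[Some _]/(vadd (Some p.1) (Some q.1)) vleD.
Qed.
Definition fsM s t := FSum (fsM_subproof s t).

Lemma fcoef0 g : fcoef fs0 g = 0. Proof. by rewrite /fcoef big_nil. Qed.

Lemma fcoef1 g : fcoef fs1 g = if g == 0 then 1 else 0.
Proof. by rewrite /fcoef big_mkcond big_seq1 /= eq_sym. Qed.

Lemma fcoefD s t g : fcoef (fsD s t) g = fcoef s g + fcoef t g.
Proof. by rewrite /fcoef big_cat. Qed.

Lemma fcoefN s g : fcoef (fsN s) g = - fcoef s g.
Proof. by rewrite /fcoef big_map /= sumrN. Qed.

Lemma fcoefMl s t g :
  fcoef (fsM s t) g = \sum_(p <- s) p.2 * fcoef t (g - p.1).
Proof.
rewrite /fcoef [LHS]big_mkcond big_allpairs_dep /=; apply: eq_bigr => p _.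
rewrite big_distrr [RHS]big_mkcond /=; apply: eq_bigr => q _.
by rewrite -subr_eq0 [q.1 == _]eq_sym -[g - _ == _]subr_eq0 -oppr_eq0 opprB opprD addrA.
Qed.

Lemma fcoefMr s t g :
  fcoef (fsM s t) g = \sum_(q <- t) fcoef s (g - q.1) * q.2.
Proof.
rewrite /fcoef [LHS]big_mkcond big_allpairs_dep /= exchange_big.
apply: eq_bigr => q _.
rewrite big_distrl [RHS]big_mkcond /=; apply: eq_bigr => p _.
by rewrite [p.1 == _]eq_sym subr_eq eq_sym.
Qed.

Lemma vle_fcoef s g : vle (Some g) (v (fcoef s g)).
Proof.
by rewrite /fcoef big_seq_cond; apply: vle_sum => p /andP[/fsum_le + /eqP<-].
Qed.

Definition fs_equiv s t : bool :=
  all (fun g => vlt (Some g) (v (fcoef s g - fcoef t g)))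
      [seq p.1 | p <- (s : seq _) ++ t].

Lemma fs_equivP s t :
  reflect (forall g, vlt (Some g) (v (fcoef s g - fcoef t g))) (fs_equiv s t).
Proof.
apply: (iffP allP) => [h g|h g _]; last exact: h.
have [/h//|gNst] := boolP (g \in [seq p.1 | p <- (s : seq _) ++ t]).
have c0 (r : fsum) : {subset (r : seq _) <= (s : seq _) ++ t} -> fcoef r g = 0.
  move=> sub; rewrite /fcoef big_seq_cond big1 // => p /andP[/sub pst /eqP pg].
  by case/negP: gNst; rewrite -pg map_f.
by rewrite !c0 ?subrr ?vlt0 // => p hp; rewrite mem_cat hp ?orbT.
Qed.

Fact fs_equiv_is_equiv : equiv_class_of fs_equiv.
Proof.
split=> [s|s t|t s u].
- by apply/fs_equivP=> g; rewrite subrr vlt0.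
- by apply/fs_equivP/fs_equivP=> h g; rewrite -opprB valN.
- move=> /fs_equivP h1 /fs_equivP h2; apply/fs_equivP=> g.
  by rewrite -(subrK (fcoef t g) (fcoef s g)) -addrA vlt_add.
Qed.

Canonical fs_equiv_equiv := EquivRelPack fs_equiv_is_equiv.
Canonical fs_equiv_encModRel := defaultEncModRel fs_equiv.

Definition gr := {eq_quot fs_equiv}.

HB.instance Definition _ : EqQuotient fsum fs_equiv gr := EqQuotient.on gr.
HB.instance Definition _ := Choice.on gr.

Lemma gr_piP s t :
  \pi_gr s = \pi_gr t <->
  forall g, vlt (Some g) (v (fcoef s g - fcoef t g)).
Proof. by split=> [/eqmodP/fs_equivP//|h]; apply/eqmodP/fs_equivP. Qed.

Lemma gr_pi_coef s t : fcoef s =1 fcoef t -> \pi_gr s = \pi_gr t.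
Proof. by move=> h; apply/gr_piP=> g; rewrite h subrr vlt0. Qed.

Lemma gr_reprP s g : vlt (Some g) (v (fcoef (repr (\pi_gr s)) g - fcoef s g)).
Proof. by move: g; apply/gr_piP; rewrite reprK. Qed.

Definition gr0 : gr := \pi_gr fs0.
Definition gr1 : gr := \pi_gr fs1.
Definition grD (x y : gr) : gr := \pi_gr (fsD (repr x) (repr y)).
Definition grN (x : gr) : gr := \pi_gr (fsN (repr x)).
Definition grM (x y : gr) : gr := \pi_gr (fsM (repr x) (repr y)).

Lemma gr_piD s t : \pi_gr (fsD s t) = grD (\pi_gr s) (\pi_gr t).
Proof.
apply/esym/gr_piP=> g; rewrite !fcoefD opprD addrACA.
by apply: vlt_add; exact: gr_reprP.
Qed.

Lemma gr_piN s : \pi_gr (fsN s) = grN (\pi_gr s).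
Proof.
by apply/esym/gr_piP=> g; rewrite !fcoefN -opprD valN; exact: gr_reprP.
Qed.

Lemma gr_piM s t : \pi_gr (fsM s t) = grM (\pi_gr s) (\pi_gr t).
Proof.
apply/esym; transitivity (\pi_gr (fsM (repr (\pi_gr s)) t)); apply/gr_piP=> g.
  rewrite !fcoefMl -sumrB big_seq.
  elim/big_ind: _ => [|x y|p /fsum_le hp]; [exact: vlt0|exact: vlt_add|].
  rewrite -mulrBr val_mul -[X in Some X](addrNK p.1) addrC.
  by apply: vltDr => //; exact: gr_reprP.
rewrite !fcoefMr -sumrB big_seq.
elim/big_ind: _ => [|x y|p /fsum_le hp]; [exact: vlt0|exact: vlt_add|].
rewrite -mulrBl val_mul -[X in Some X](addrNK p.1).
by apply: vltDl => //; exact: gr_reprP.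
Qed.

Lemma gr_ind (P : gr -> Prop) : (forall s, P (\pi_gr s)) -> forall x, P x.
Proof. by move=> h x; rewrite -[x]reprK. Qed.

Fact grDA : associative grD.
Proof.
elim/gr_ind=> s; elim/gr_ind=> t; elim/gr_ind=> u; rewrite -!gr_piD.
by apply: gr_pi_coef => g; rewrite !fcoefD addrA.
Qed.

Fact grDC : commutative grD.
Proof.
elim/gr_ind=> s; elim/gr_ind=> t; rewrite -!gr_piD.
by apply: gr_pi_coef => g; rewrite !fcoefD addrC.
Qed.

Fact gr0D : left_id gr0 grD.
Proof.
elim/gr_ind=> s; rewrite -!gr_piD.
by apply: gr_pi_coef => g; rewrite !fcoefD fcoef0 add0r.
Qed.

Fact grND : left_inverse gr0 grN grD.
Proof.
elim/gr_ind=> s; rewrite -gr_piN -!gr_piD.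
by apply: gr_pi_coef => g; rewrite !fcoefD fcoefN fcoef0 addNr.
Qed.

Fact grMA : associative grM.
Proof.
elim/gr_ind=> s; elim/gr_ind=> t; elim/gr_ind=> u; rewrite -!gr_piM.
apply: gr_pi_coef => g; rewrite fcoefMl fcoefMr.
under eq_bigr do rewrite fcoefMr big_distrr /=.
under [RHS]eq_bigr do rewrite fcoefMl big_distrl /=.
rewrite exchange_big /=; apply: eq_bigr => q _; apply: eq_bigr => p _.
by rewrite mulrA addrAC.
Qed.

Fact gr1M : left_id gr1 grM.
Proof.
elim/gr_ind=> s; rewrite -!gr_piM.
by apply: gr_pi_coef => g; rewrite fcoefMl big_seq1 /= subr0 mul1r.
Qed.

Fact grM1 : right_id gr1 grM.
Proof.
elim/gr_ind=> s; rewrite -!gr_piM.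
by apply: gr_pi_coef => g; rewrite fcoefMr big_seq1 /= subr0 mulr1.
Qed.

Fact grMDl : left_distributive grM grD.
Proof.
elim/gr_ind=> s; elim/gr_ind=> t; elim/gr_ind=> u; rewrite -!(gr_piM, gr_piD).
apply: gr_pi_coef => g; rewrite fcoefD !fcoefMr -big_split /=.
by apply: eq_bigr => p _; rewrite fcoefD mulrDl.
Qed.

Fact grMDr : right_distributive grM grD.
Proof.
elim/gr_ind=> s; elim/gr_ind=> t; elim/gr_ind=> u; rewrite -!(gr_piM, gr_piD).
apply: gr_pi_coef => g; rewrite fcoefD !fcoefMl -big_split /=.
by apply: eq_bigr => p _; rewrite fcoefD mulrDr.
Qed.

Fact gr1_neq0 : gr1 != gr0.
Proof.
apply/eqP=> /gr_piP/(_ 0).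
by rewrite fcoef1 eqxx fcoef0 subr0 val1 /vlt /vle lexx.
Qed.

HB.instance Definition _ := GRing.isZmodule.Build gr grDA grDC gr0D grND.
HB.instance Definition _ :=
  GRing.Zmodule_isNzRing.Build gr grMA gr1M grM1 grMDl grMDr gr1_neq0.

(** [gr_class g a] is the class a + R^{>g} placed in degree [g]; it is
    meaningful when [g <= v a] and [0] by convention otherwise. *)

Fact fs_single_subproof g a :
  all (fun p => vle (Some p.1) (v p.2))
      (if vle (Some g) (v a) then [:: (g, a)] else [::]).
Proof. by case: ifP => //= ->. Qed.
Definition fs_single g a := FSum (fs_single_subproof g a).

Definition gr_class (g : G) (a : R) : gr := \pi_gr (fs_single g a).

Definition homogeneous (x : gr) : Prop :=
  exists g a, vle (Some g) (v a) /\ x = gr_class g a.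

Definition gr_tilde (a : R) : gr :=
  if v a is Some g then gr_class g a else 0.

Lemma fcoef_single g a h : vle (Some g) (v a) ->
  fcoef (fs_single g a) h = if g == h then a else 0.
Proof. by rewrite /fs_single /fcoef /= => ->; rewrite big_mkcond big_seq1. Qed.

Lemma gr_class_eq0 g a : vle (Some g) (v a) ->
  gr_class g a = 0 <-> vlt (Some g) (v a).
Proof.
move=> ga; split=> [/gr_piP/(_ g)|ha].
  by rewrite fcoef_single // eqxx fcoef0 subr0.
apply/gr_piP=> h; rewrite fcoef_single // fcoef0 subr0.
by case: eqP => [<-|_] //; rewrite vlt0.
Qed.

Lemma gr_classD g a b : vle (Some g) (v a) -> vle (Some g) (v b) ->
  gr_class g (a + b) = gr_class g a + gr_class g b.
Proof.
move=> ga gb; rewrite /gr_class -[RHS]gr_piD; apply: gr_pi_coef => h.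
by rewrite fcoefD !fcoef_single ?vle_add //; case: eqP; rewrite ?addr0.
Qed.

Lemma gr_classM g h a b : vle (Some g) (v a) -> vle (Some h) (v b) ->
  gr_class g a * gr_class h b = gr_class (g + h) (a * b).
Proof.
move=> ga hb; rewrite /gr_class -[LHS]gr_piM; apply: gr_pi_coef => k.
rewrite fcoefMl /= ga big_seq1 /= !fcoef_single //; last first.
  by rewrite val_mul -[Some _]/(vadd (Some g) (Some h)) vleD.
by rewrite eq_sym subr_eq [_ + g]addrC eq_sym; case: eqP; rewrite ?mulr0.
Qed.

Lemma gr_tildeM a b : gr_tilde (a * b) = gr_tilde a * gr_tilde b.
Proof.
rewrite /gr_tilde val_mul; case Ea: (v a) => [g|] /=; last by rewrite mul0r.
case Eb: (v b) => [h|] /=; last by rewrite mulr0.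
by rewrite gr_classM ?Ea ?Eb ?vle_refl.
Qed.

(** [gr v] is the internal direct sum of its homogeneous components. *)

Lemma gr_decomp (x : gr) : exists s : fsum,
  x = \sum_(p <- s) gr_class p.1 p.2.
Proof.
exists (repr x); rewrite -[LHS]reprK; move: (repr x) => [s hs] /=.
elim: s hs => [|p s IHs] hps /=; first by rewrite big_nil; apply: gr_pi_coef.
have /andP[/= hp hs] := hps.
rewrite big_cons -(IHs hs) -[RHS]gr_piD; apply: gr_pi_coef => g.
rewrite fcoefD fcoef_single //.
by rewrite /fcoef /= big_cons; case: eqP => _ //; rewrite add0r.
Qed.

Lemma gr_direct (r : seq G) (a : G -> R) : uniq r ->
  (forall g, vle (Some g) (v (a g))) ->
  \sum_(g <- r) gr_class g (a g) = 0 -> {in r, forall g, gr_class g (a g) = 0}.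
Proof.
move=> ur ha; have: exists s : fsum,
    \sum_(g <- r) gr_class g (a g) = \pi_gr s /\
    forall g, fcoef s g = \sum_(h <- r | h == g) a h.
  elim: r {ur} => [|h r [s [Es cs]]]; first by
    exists fs0; rewrite big_nil; split=> // g; rewrite fcoef0 big_nil.
  exists (fsD (fs_single h (a h)) s); rewrite big_cons Es gr_piD; split=> // g.
  by rewrite fcoefD fcoef_single // big_cons cs; case: eqP => // _; rewrite add0r.
case=> s [-> cs] /gr_piP s0 g gr; apply/gr_class_eq0 => //.
have := s0 g; rewrite fcoef0 subr0 cs big_mkcond (bigD1_seq g) //= eqxx.
by rewrite big1 ?addr0 // => h /negPf->.
Qed.

End FormalSums.

Section GrMap.
Variables (G : orderedGroupType) (K : fieldType) (R : nzRingType).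
Variables (f : {rmorphism K -> R}) (w : valuation G R).
Local Notation v := (restrict_valuation f w).
Implicit Types s t : fsum v.

Fact fs_map_subproof s :
  all (fun p => vle (Some p.1) (w p.2)) [seq (p.1, f p.2) | p <- s].
Proof. by apply/allP=> _ /mapP[p /fsum_le hp ->]. Qed.
Definition fs_map s := FSum (fs_map_subproof s).

(** The map induced by [f] on graded rings, a + K^{>g} |-> f a + R^{>g}. *)
Definition gr_map (x : gr v) : gr w := \pi_(gr w) (fs_map (repr x)).

Lemma fcoef_map s g : fcoef (fs_map s) g = f (fcoef s g).
Proof. by rewrite /fcoef big_map /= rmorph_sum. Qed.

Lemma gr_map_pi s : gr_map (\pi_(gr v) s) = \pi_(gr w) (fs_map s).
Proof.
by apply/gr_piP=> g; rewrite !fcoef_map -rmorphB; exact: (gr_reprP s).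
Qed.

Fact gr_map_is_zmod_morphism : zmod_morphism gr_map.
Proof.
elim/gr_ind=> s; elim/gr_ind=> t.
have -> : \pi_(gr v) s - \pi_(gr v) t = \pi_(gr v) (fsD s (fsN t)).
  by rewrite gr_piD gr_piN.
rewrite !gr_map_pi -[- _]gr_piN -[RHS]gr_piD; apply: gr_pi_coef => g.
by rewrite !(fcoefD, fcoefN, fcoef_map) rmorphB.
Qed.

Fact gr_map_is_monoid_morphism : monoid_morphism gr_map.
Proof.
split.
  rewrite -[1]/(\pi_(gr v) (fs1 v)) gr_map_pi; apply: gr_pi_coef => g.
  by rewrite fcoef_map !fcoef1 (fun_if f) rmorph1 rmorph0.
elim/gr_ind=> s; elim/gr_ind=> t.
rewrite -[_ * _ in LHS]gr_piM !gr_map_pi -[RHS]gr_piM.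
apply: gr_pi_coef => g; rewrite fcoef_map !fcoefMl big_map rmorph_sum.
by apply: eq_bigr => p _; rewrite rmorphM fcoef_map.
Qed.

HB.instance Definition _ :=
  GRing.isZmodMorphism.Build (gr v) (gr w) gr_map gr_map_is_zmod_morphism.
HB.instance Definition _ :=
  GRing.isMonoidMorphism.Build (gr v) (gr w) gr_map gr_map_is_monoid_morphism.

Lemma gr_map_inj : injective gr_map.
Proof.
elim/gr_ind=> s; elim/gr_ind=> t; rewrite !gr_map_pi => /gr_piP h.
by apply/gr_piP=> g; have := h g; rewrite !fcoef_map -rmorphB.
Qed.

Lemma gr_map_class g a : gr_map (gr_class v g a) = gr_class w g (f a).
Proof.
rewrite gr_map_pi; apply: gr_pi_coef => h.
rewrite fcoef_map /fcoef /=; case: ifP => _; last by rewrite !big_nil rmorph0.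
by rewrite big_mkcond [RHS]big_mkcond !big_seq1 /= (fun_if f) rmorph0.
Qed.

End GrMap.

Arguments gr_map {G K R} f w x.

Section Tame.
Variables (G : orderedGroupType) (K : fieldType) (D : falgType K).
Variable w : valuation G D.

Definition base_valuation : valuation G K := restrict_valuation (in_alg D) w.
Definition gr_base : gr base_valuation -> gr w := gr_map (in_alg D) w.

(** [n = [gr(D) : gr(K)]]: the graded gr(K)-module gr(D) has a basis of [n]
    homogeneous elements. *)
Definition graded_rank (n : nat) : Prop :=
  exists b : 'I_n -> gr w,
    (forall i, homogeneous (b i)) /\
    (forall x : gr w, exists! c : {ffun 'I_n -> gr base_valuation},
        x = \sum_i gr_base (c i) * b i).

Definition tame : Prop :=
  graded_rank (\dim {:D})
  /\ (forall z : gr w,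
        (forall x, z * x = x * z) <-> exists c, z = gr_base c).

End Tame.

Section MultiplicativeGroup.
Variable D : unitRingType.
Implicit Types H M : D -> Prop.

(** Intended for [D] a division ring, whose multiplicative group consists of
    all nonzero elements. *)
Definition mul_subgroup H : Prop :=
  [/\ forall x, H x -> x != 0, H 1,
      forall x y, H x -> H y -> H (x * y) & forall x, H x -> H x^-1].

Definition proper_subgroup H : Prop :=
  mul_subgroup H /\ exists2 x : D, x != 0 & ~ H x.

Definition maximal_subgroup M : Prop :=
  proper_subgroup M /\
  ~ exists H, [/\ proper_subgroup H, forall x, M x -> H x
                & exists2 x, H x & ~ M x].

Definition abelian_subset M : Prop :=
  forall x y, M x -> M y -> x * y = y * x.

End MultiplicativeGroup.

(* Main.v *)
Require Import Defs.
From HB Require Import structures.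
From mathcomp Require Import all_boot all_order all_algebra all_field.
From Stdlib Require Import Classical.
Import Order.POrderTheory GRing.Theory.
Local Open Scope ring_scope.

Set Implicit Arguments.
Unset Strict Implicit.

(** An abelian maximal subgroup M equals its own centralizer in D^*, so M and 0
    form a subfield.  The 1-units U = {u | w (u - 1) > 0} are normal in D^*,
    hence M U is M or D^*.  If U lies in M, then M contains every element of
    positive value, and so all of D^* because w is nontrivial.
    If M U = D^*, every a in D^* has the same leading term as some element of
    M, so gr(D) is commutative; tameness then gives gr(D) = gr(K) and
    [D : K] = 1. *)

(** * Maximal subgroups and centralizers *)

Section MaximalSubgroups.
Variable D : unitRingType.
Hypothesis divD : GRing.field_axiom D.
Implicit Types (x y z : D) (H M : D -> Prop).

Lemma division_mulf_neq0 x y : x != 0 -> y != 0 -> x * y != 0.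
Proof.
move=> x0; apply: contra_neq => xy0.
by apply: (mulrI (divD x0)); rewrite xy0 mulr0.
Qed.

Lemma mul_subgroup_centralizer (S : D -> Prop) :
  mul_subgroup (fun x => x != 0 /\ forall y, S y -> x * y = y * x).
Proof.
split=> [x []//||x y [x0 cx] [y0 cy]|x [x0 cx]].
- by split=> [|y _]; rewrite ?oner_eq0 // mul1r mulr1.
- split=> [|z Sz]; first exact: division_mulf_neq0.
  by rewrite -mulrA cy // mulrA cx // mulrA.
- have ux := divD x0; split=> [|y Sy]; first by rewrite invr_eq0.
  by apply: (mulrI ux); rewrite mulVKr // mulrA cx // mulrK.
Qed.

(** Maximality only denies an intermediate proper subgroup; turning this into an alternative takes
    excluded middle, as [M] and [H] are arbitrary predicates. *)
Lemma maximal_subgroup_eq_or_full M H :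
    maximal_subgroup M -> mul_subgroup H -> (forall x, M x -> H x) ->
  (forall x, H x -> M x) \/ (forall x, x != 0 -> H x).
Proof.
move=> [_ maxM] gH sMH.
have [|nHM] := classic (exists2 x, H x & ~ M x); last first.
  by left=> x Hx; apply: NNPP => nMx; apply: nHM; exists x.
move=> HnM; right=> x x0; apply: NNPP => nHx.
by apply: maxM; exists H; do 2?split=> //; exists x.
Qed.

(** Being abelian, [M] lies in its centralizer, which by maximality is [M] or all of D^*; the second
    case would make D commutative. *)
Lemma abelian_maximal_subgroup_centralizer M x :
    (exists y z : D, y * z <> z * y) ->
    maximal_subgroup M -> abelian_subset M ->
  x != 0 -> (forall y, M y -> x * y = y * x) -> M x.
Proof.
move=> ncD maxM abM x0 cx; have [[gM _] _] := maxM.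
have M0 := let: And4 h _ _ _ := gM in h.
have sMC y : M y -> y != 0 /\ forall z, M z -> y * z = z * y.
  by move=> My; split=> [|z Mz]; [apply: M0|apply: abM].
have [|fullC] := maximal_subgroup_eq_or_full maxM
  (mul_subgroup_centralizer M) sMC; first by apply.
(* Now M is central, so the centralizer of a noncentral y contains M and is
   proper, hence equals M; then y itself is central. *)
case: ncD => y [z nyz]; case: (nyz).
have y0 : y != 0 by apply/eqP=> y0; apply: nyz; rewrite y0 mul0r mulr0.
have sMCy a : M a -> a != 0 /\ forall b, b = y -> a * b = b * a.
  by move=> Ma; split=> [|b ->]; [apply: M0|rewrite (fullC y y0).2].
have [CyM|fullCy] := maximal_subgroup_eq_or_full maxM
  (mul_subgroup_centralizer (fun b => b = y)) sMCy.
- have My : M y by apply: CyM; split=> // b ->.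
  have [->|z0] := eqVneq z 0; first by rewrite mul0r mulr0.
  by rewrite (fullC z z0).2.
- have [->|z0] := eqVneq z 0; first by rewrite mul0r mulr0.
  by rewrite (fullCy z z0).2.
Qed.

End MaximalSubgroups.

(** * 1-units and leading terms in gr(D) *)

Section OneUnits.
Variables (G : orderedGroupType) (D : unitRingType) (w : valuation G D).
Hypothesis divD : GRing.field_axiom D.
Implicit Types (a u : D) (M : D -> Prop).

Definition one_unit u : bool := vlt (Some 0) (w (u - 1)).

Lemma one_unit1 : one_unit 1.
Proof. by rewrite /one_unit subrr vlt0. Qed.

(** From u = (u - 1) + 1 the value is at least 0; were it positive, 1 = u - (u - 1) would have
    positive value too. *)
Lemma one_unitP u : one_unit u -> w u = Some 0.
Proof.
move=> u1; have: vle (Some 0) (w u).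
  rewrite -(subrK 1 u); apply: vle_add; first exact: vltW.
  by rewrite Defs.val1 vle_refl.
have: ~~ vlt (Some 0) (w u).
  apply/negP=> u0; have: vlt (Some 0) (w 1).
    by rewrite -(subKr u 1); apply: vlt_add; rewrite // valN.
  by rewrite Defs.val1 /vlt vle_refl.
rewrite /vlt negbK; case: (w u) => [g|] // g0 g1.
by congr Some; apply: le_anti; apply/andP; split.
Qed.

Lemma val_mulV a : a \is a GRing.unit -> vadd (w a^-1) (w a) = Some 0.
Proof. by move=> ua; rewrite -val_mul mulVr // Defs.val1. Qed.

Lemma one_unit_neq0 u : one_unit u -> u != 0.
Proof. by move/one_unitP=> wu; apply/eqP=> /(val_infP w); rewrite wu. Qed.

Lemma one_unitM u1 u2 : one_unit u1 -> one_unit u2 -> one_unit (u1 * u2).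
Proof.
move=> h1 h2; rewrite /one_unit.
have -> : u1 * u2 - 1 = (u1 - 1) * u2 + (u2 - 1).
  by rewrite mulrBl mul1r addrA subrK.
apply: vlt_add => //; rewrite val_mul -[X in Some X](addr0 0).
by apply: vltDl; rewrite // (one_unitP h2) vle_refl.
Qed.

Lemma one_unitV u : one_unit u -> one_unit u^-1.
Proof.
move=> h; have uu := divD (one_unit_neq0 h); rewrite /one_unit.
have -> : u^-1 - 1 = u^-1 * (1 - u) by rewrite mulrBr mulr1 mulVr.
rewrite val_mul -[w (1 - u)]valN opprB.
have := val_mulV uu; rewrite (one_unitP h).
case: (w u^-1) => [g|] //= []; rewrite addr0 => ->.
by move: h; rewrite /one_unit; case: (w (u - 1)) => //= g'; rewrite add0r.
Qed.

Lemma one_unitJ a u : a != 0 -> one_unit u -> one_unit (a^-1 * u * a).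
Proof.
move=> /divD ua h; rewrite /one_unit.
have -> : a^-1 * u * a - 1 = a^-1 * (u - 1) * a.
  by rewrite mulrBr mulr1 mulrBl mulVr.
have := val_mulV ua; move: h; rewrite /one_unit !val_mul.
case: (w a^-1) (w (u - 1)) (w a) => [g|] [k|] [h|] //= uk [gh0].
by rewrite addrAC gh0 add0r.
Qed.

(** Normality of the 1-units ([one_unitJ]) lets the factors from [M] be collected on the left. *)
Lemma mul_subgroup_one_units M : mul_subgroup M ->
  mul_subgroup (fun x => exists m u, [/\ M m, one_unit u & x = m * u]).
Proof.
move=> [M0 M1 MM MV]; split.
- move=> _ [m [u [Mm u1 ->]]].
  by apply: (division_mulf_neq0 divD); [exact: M0|exact: one_unit_neq0].
- by exists 1, 1; rewrite one_unit1 mulr1.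
- move=> _ _ [m [u [Mm u1 ->]]] [n [u' [Mn u1' ->]]].
  (* m u n u' = (m n) (n^-1 u n) u'. *)
  exists (m * n), (n^-1 * u * n * u'); split; first exact: MM.
    by apply: one_unitM => //; apply: one_unitJ => //; apply: M0.
  by rewrite !mulrA mulrK // divD ?M0.
- move=> _ [m [u [Mm u1 ->]]].
  have um := divD (M0 m Mm); have uu := divD (one_unit_neq0 u1).
  (* (m u)^-1 = m^-1 (m u^-1 m^-1), with m written as [m^-1^-1] to match [one_unitJ]. *)
  exists m^-1, (m^-1^-1 * u^-1 * m^-1); split; first exact: MV.
    by apply: one_unitJ; [rewrite invr_eq0 M0|apply: one_unitV].
  by rewrite invrK !mulrA mulVr // mul1r invrM.
Qed.

(** The class is 0 by convention above the value of [a] and 0 in the quotient below it; only degree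
    [w a] gives the leading term. *)
Lemma gr_class_tilde g a : gr_class w g a = 0 \/ gr_class w g a = gr_tilde w a.
Proof.
have [ga|nga] := boolP (vle (Some g) (w a)); last first.
  by left; apply: gr_pi_coef => h; rewrite /fcoef /= (negPf nga).
have [lga|] := boolP (vlt (Some g) (w a)).
  by left; apply/gr_class_eq0.
rewrite /vlt negbK /gr_tilde; case: (w a) ga => [h|] // gh hg; right.
by congr gr_class; apply: le_anti; apply/andP; split.
Qed.

(** In degree 0 the summand u - 1 of u = (u - 1) + 1 vanishes. *)
Lemma gr_tilde_one_unit u : one_unit u -> gr_tilde w u = 1.
Proof.
move=> u1; have w1 := Defs.val1 w; have wu := one_unitP u1; rewrite /gr_tilde wu.
rewrite -(subrK 1 u) gr_classD ?w1 ?vle_refl //; last exact: vltW.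
have -> : gr_class w 0 (u - 1) = 0 by apply/gr_class_eq0 => //; exact: vltW.
rewrite add0r; apply: gr_pi_coef => g.
by rewrite fcoef_single ?w1 ?vle_refl // fcoef1 eq_sym.
Qed.

Lemma gr_commutative :
    (forall a b, gr_tilde w a * gr_tilde w b = gr_tilde w b * gr_tilde w a) ->
  commutative (@GRing.mul (gr w)).
Proof.
move=> ctilde x y; have [s ->] := gr_decomp x; have [t ->] := gr_decomp y.
rewrite mulr_suml mulr_sumr; apply: eq_bigr => p _.
rewrite mulr_sumr mulr_suml; apply: eq_bigr => q _.
have [->|->] := gr_class_tilde p.1 p.2; first by rewrite mul0r mulr0.
have [->|->] := gr_class_tilde q.1 q.2; first by rewrite mul0r mulr0.
exact: ctilde.
Qed.

End OneUnits.

(** * Tame algebras with commutative graded ring *)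

Section TameCommutative.
Variables (K : fieldType) (D : falgType K) (G : orderedGroupType).
Variable w : valuation G D.

(** Two basis elements b0, b1 coming from c0, c1 in gr(K) satisfy c1 b0 - c0 b1 = 0. Independence
    gives c1 = 0, so b1 = 0, which is absurd for a basis element. *)
Lemma graded_rank_le1 n :
    commutative (@GRing.mul (gr w)) ->
    (forall z : gr w, exists c, z = gr_base c) ->
  graded_rank w n -> (n <= 1)%N.
Proof.
move=> cw grE [b [_ ub]]; rewrite leqNgt; apply/negP=> n1.
pose i0 := Ordinal (ltnW n1); pose i1 := Ordinal n1.
have i10 : i1 != i0 by [].
have free (c : {ffun 'I_n -> _}) :
    0 = \sum_i gr_base (c i) * b i -> c = [ffun=> 0].
  have [c' [_ uc]] := ub 0 => hc; rewrite -(uc c hc); apply: uc.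
  by rewrite big1 // => i _; rewrite ffunE /gr_base raddf0 mul0r.
have [c0 b0] := grE (b i0); have [c1 b1] := grE (b i1).
have := free [ffun i => if i == i0 then c1 else if i == i1 then - c0 else 0].
rewrite (bigD1 i0) // (bigD1 i1) //= big1 => [|i /andP[/negPf h0 /negPf h1]].
  rewrite !ffunE /= b0 b1 /gr_base raddfN mulNr cw addr0 subrr => /(_ erefl).
  move/ffunP=> /(_ i0); rewrite !ffunE /= => c10.
  have := free [ffun i => if i == i1 then 1 else 0].
  rewrite (bigD1 i1) //= big1 => [|i /negPf h1].
    rewrite b1 c10 /gr_base raddf0 mulr0 addr0 => /(_ erefl).
    by move/ffunP=> /(_ i1); rewrite !ffunE eqxx => /eqP; rewrite oner_eq0.
  by rewrite ffunE h1 /gr_base raddf0 mul0r.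
by rewrite ffunE h0 h1 /gr_base raddf0 mul0r.
Qed.

(** A commutative gr(D) is its own center, hence gr(K); the rank [D : K] is then at most 1 and D
    consists of scalars. *)
Lemma tame_commutative : tame w -> commutative (@GRing.mul (gr w)) ->
  commutative (@GRing.mul D).
Proof.
move=> [rk Zgr] cw; have grE (z : gr w) : exists c, z = gr_base c.
  by apply/Zgr => x; exact: cw.
have dim1 := graded_rank_le1 cw grE rk.
have e1 : (1 = {:D})%VS by apply/eqP; rewrite eqEdim subvf dimv1.
move=> x y; have := memvf x; have := memvf y; rewrite -e1.
by move=> /vlineP[a ->] /vlineP[b ->]; rewrite -!scalerAl !mul1r !scalerA mulrC.
Qed.

End TameCommutative.

(** * Elements of positive value and the final contradiction *)

Lemma nontrivial_valuation_gt0 (G : orderedGroupType) (D : unitRingType)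
    (w : valuation G D) :
    GRing.field_axiom D -> nontrivial_valuation w ->
  exists2 t : D, t != 0 & vlt (Some 0) (w t).
Proof.
move=> divD [x x0 wx].
have [wx0|] := boolP (vle (w x) (Some 0)); last by exists x.
(* Here [w x] is negative. *)
exists x^-1; first by rewrite invr_eq0.
have := val_mulV w (divD x x0); move: wx wx0.
case: (w x) (w x^-1) => [g|] [h|] //= wx wx0 [hg0].
apply/negP=> h0; apply: wx; congr Some.
apply: le_anti; apply/andP; split=> //.
by rewrite -hg0 -[leRHS]add0r og_leD2r.
Qed.

Lemma self_centralizing_one_units_full (G : orderedGroupType) (D : unitRingType)
    (w : valuation G D) (divD : GRing.field_axiom D) (M : D -> Prop) (t : D) :
    mul_subgroup M ->
    (forall x, x != 0 -> (forall y, M y -> x * y = y * x) -> M x) ->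
    abelian_subset M -> (forall u, one_unit w u -> M u) ->
    t != 0 -> vlt (Some 0) (w t) ->
  forall x, x != 0 -> M x.
Proof.
move=> [M0 M1 MM MV] cM abM UM t0 wt.
have inM x : x != 0 -> vlt (Some 0) (w x) -> M x.
  move=> x0 wx; apply: cM => // y My.
  (* The 1-unit 1 + x lies in [M], so it commutes with [y], and hence so does [x]. *)
  have /UM/abM/(_ My) : one_unit w (1 + x) by rewrite /one_unit addrC addKr.
  by rewrite mulrDl mulrDr mul1r mulr1 => /addrI.
move=> x x0; have [wx|] := boolP (vlt (Some 0) (w x)); first exact: inM.
rewrite /vlt negbK => wx.
have Mt : M t by apply: inM.
have [wx0|wx0] := boolP (vle (Some 0) (w x)).
  (* For value 0, x = t^-1 (t x) with t x of positive value; for negative value, the inverse is used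
     below. *)
  rewrite -(mulKr (divD t t0) x); apply: MM; first exact: MV.
  apply: inM; first exact: (division_mulf_neq0 divD).
  by rewrite val_mul -[X in Some X](addr0 0); apply: vltDl.
rewrite -[x]invrK; apply: MV; apply: inM; first by rewrite invr_eq0.
have := val_mulV w (divD x x0); move: wx wx0.
case: (w x) (w x^-1) => [g|] [h|] //= wx wx0 [hg0].
apply: contra wx0 => h0.
by rewrite /vle -hg0 -[leRHS]add0r og_leD2r.
Qed.

Unset Implicit Arguments.

Theorem theorem1p2
    (K : fieldType) (G : orderedGroupType) (v : valuation G K)
    (D : falgType K) (G' : orderedGroupType) (j : G -> G')
    (w : valuation G' D)
    (henselK : henselian v) (ntK : nontrivial_valuation v)
    (divD : GRing.field_axiom D) (centralD : ('Z({: D}) = 1)%VS)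
    (w_ext : extends_valuation j (in_alg D) v w)
    (tameD : tame w)
    (ncD : exists x y : D, x * y <> y * x) :
  ~ exists M : D -> Prop, maximal_subgroup M /\ abelian_subset M.
Proof.
move=> [M [maxM abM]]; have [[gM [z z0 nMz]] _] := maxM.
have [_ M1 _ _] := gM.
have [t t0 wt] : exists2 t : D, t != 0 & vlt (Some 0) (w t).
  apply: nontrivial_valuation_gt0 => //.
  (* Nontriviality passes from [v] to [w]: [j] fixes 0, as the value of 1 shows, and is injective
     because it reflects the order. *)
  have [_ jmono wE] := w_ext; case: ntK => c c0 vc.
  exists (in_alg D c); first by rewrite fmorph_eq0.
  rewrite wE; case: (v c) vc => [g|] //= vg [jg0]; apply: vg; congr Some.
  have j0 : j 0 = 0 by have := wE 1; rewrite rmorph1 !Defs.val1 => -[<-].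
  by apply: le_anti; rewrite -!jmono jg0 j0 lexx.
have [UM|MUfull] := maximal_subgroup_eq_or_full maxM
    (mul_subgroup_one_units w divD gM)
    (fun x Mx => ex_intro _ x (ex_intro _ 1
       (And3 Mx (one_unit1 w) (esym (mulr1 x))))).
- apply: nMz; apply: (@self_centralizing_one_units_full _ _ w divD M t) => //.
  + by move=> x x0; apply: abelian_maximal_subgroup_centralizer.
  + by move=> u u1; apply: UM; exists 1, u; rewrite mul1r.
- case: ncD => x [y]; apply; apply: tame_commutative tameD _ x y.
  apply: gr_commutative => a b.
  (* Since M U = D^*, leading terms can be taken from the abelian group [M]. *)
  have tildeM c : c != 0 -> exists2 m, M m & gr_tilde w c = gr_tilde w m.
    move=> /MUfull[m [u [Mm u1 ->]]]; exists m => //.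
    by rewrite gr_tildeM (gr_tilde_one_unit u1) mulr1.
  have [->|/tildeM[m Mm ->]] := eqVneq a 0.
    by rewrite -!gr_tildeM mul0r mulr0.
  have [->|/tildeM[n Mn ->]] := eqVneq b 0.
    by rewrite -!gr_tildeM mul0r mulr0.
  by rewrite -!gr_tildeM abM.
Qed.
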